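(* Let $\mathcal{C}$ be a nondegenerate $[n,k,d]_{q^m/q}$ rank-metric code and let $\mathcal{C}^{\mathrm{H}}$ be any Hamming-metric code associated with $\mathcal{C}$. Then $\mathcal{C}$ is (rank-)minimal if and only if $\mathcal{C}^{\mathrm{H}}$ is Hamming-minimal.
   Context: Let $q$ be a prime power and $n,m,k$ positive integers. For $v\in\mathbb{F}_{q^m}^n$ and an ordered basis $\Gamma=(\gamma_1,\dots,\gamma_m)$ of $\mathbb{F}_{q^m}$ over $\mathbb{F}_q$, let $\Gamma(v)\in\mathbb{F}_q^{n\times m}$ be the matrix with $v_i=\sum_{j}\Gamma(v)_{ij}\gamma_j$. The rank support $\sigma^{\mathrm{rk}}(v)\subseteq\mathbb{F}_q^n$ is the column space of $\Gamma(v)$ (independent of $\Gamma$), and $\mathrm{rk}(v)=\dim_{\mathbb{F}_q}\sigma^{\mathrm{rk}}(v)$. An $[n,k,d]_{q^m/q}$ code is a $k$-dimensional $\mathbb{F}_{q^m}$-subspace $\mathcal{C}\subseteq\mathbb{F}_{q^m}^n$ whose nonzero codewords have minimum rank $d$; it is nondegenerate if $\sum_{v\in\mathcal{C}}\sigma^{\mathrm{rk}}(v)=\mathbb{F}_q^n$. It is (rank-)minimal if for all $v,v'\in\mathcal{C}$, $\sigma^{\mathrm{rk}}(v')\subseteq\sigma^{\mathrm{rk}}(v)$ implies $v'=\alpha v$ for some $\alpha\in\mathbb{F}_{q^m}$. A linear code $\mathcal{D}\subseteq\mathbb{F}_{q^m}^N$ is Hamming-minimal if, for every $c\in\mathcal{D}$,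 every nonzero $c'\in\mathcal{D}$ with $\{i:c'_i\neq0\}\subseteq\{i:c_i\neq0\}$ is an $\mathbb{F}_{q^m}$-multiple of $c$. Associated Hamming-metric code. Let $\mathcal{C}$ be a nondegenerate $[n,k]_{q^m/q}$ code, let $G\in\mathbb{F}_{q^m}^{k\times n}$ be a generator matrix and let $\mathcal{U}\subseteq\mathbb{F}_{q^m}^k$ be the $\mathbb{F}_q$-span of the columns of $G$. For a point $P=\langle w\rangle_{\mathbb{F}_{q^m}}$ of $\mathrm{PG}(k-1,q^m)$ set $\mathrm{wt}_{\mathcal{U}}(P)=\dim_{\mathbb{F}_q}(\mathcal{U}\cap\langle w\rangle_{\mathbb{F}_{q^m}})$ and $\mathrm{m}_{\mathcal{U}}(P)=\frac{q^{\mathrm{wt}_{\mathcal{U}}(P)}-1}{q-1}$. One has $\sum_P \mathrm{m}_{\mathcal{U}}(P)=\frac{q^n-1}{q-1}$. Let $G_{\mathrm{Ext}}$ be a $k\times\frac{q^n-1}{q-1}$ matrix over $\mathbb{F}_{q^m}$ whose columns are, in some order, nonzero representative vectors of the points $P$, each point $P$ being represented by exactly $\mathrm{m}_{\mathcal{U}}(P)$ columns. A Hamming-metric code associated with $\mathcal{C}$, denoted $\mathcal{C}^{\mathrm{H}}$, is any code of length $\frac{q^n-1}{q-1}$ over $\mathbb{F}_{q^m}$ that is monomially equivalent to (i.e. the image under an $\mathbb{F}_{q^m}$-linear Hamming isometry of) the row space of $G_{\mathrm{Ext}}$; up to monomial equivalence it does not depend on the choices made. *)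

(* Defs.v *)
From HB Require Import structures.
From mathcomp Require Import all_boot all_algebra.
From mathcomp Require Import falgebra fieldext finfield.

Set Implicit Arguments.
Unset Strict Implicit.
Unset Printing Implicit Defensive.

Import GRing.Theory.
Local Open Scope ring_scope.

(* Throughout, F is the field with q = #|F| elements and L is the extension of
   degree m of F.  Codes are L-subspaces of 'rV[L]_n. *)

Section RankMetric.
Variables (F : finFieldType) (L : fieldExtType F) (n m : nat).

Definition coord_mx (Gam : m.-tuple L) (v : 'rV[L]_n) : 'M[F]_(n, m) :=
  \matrix_(i, j) coord Gam j (v 0 i).

Definition rank_supp (Gam : m.-tuple L) (v : 'rV[L]_n) : {vspace 'cV[F]_n} :=
  <<[seq col j (coord_mx Gam v) | j : 'I_m]>>%VS.

Definition rk (Gam : m.-tuple L) (v : 'rV[L]_n) : nat := \dim (rank_supp Gam v).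

Definition min_rank_distance (Gam : m.-tuple L) (C : {vspace 'rV[L]_n})
    (d : nat) : Prop :=
  (exists v, [/\ v \in C, v != 0 & rk Gam v = d]) /\
  (forall v, v \in C -> v != 0 -> (d <= rk Gam v)%N).

Definition rank_metric_code (Gam : m.-tuple L) (C : {vspace 'rV[L]_n})
    (k d : nat) : Prop :=
  \dim C = k /\ min_rank_distance Gam C d.

(* finvect_type L is L itself, with the finType structure that makes the sum
   over all codewords a finite one. *)
Definition rank_nondegenerate (Gam : m.-tuple L) (C : {vspace 'rV[L]_n}) : Prop :=
  (\sum_(v : 'rV[finvect_type L]_n | (v : 'rV[L]_n) \in C)
      rank_supp Gam v)%VS = fullv.

Definition rank_minimal (Gam : m.-tuple L) (C : {vspace 'rV[L]_n}) : Prop :=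
  forall v v', v \in C -> v' \in C ->
    (rank_supp Gam v' <= rank_supp Gam v)%VS -> exists a : L, v' = a *: v.

End RankMetric.

Section HammingMetric.
Variables (K : fieldType) (N : nat).

Definition hamming_supp (c : 'rV[K]_N) : {set 'I_N} := [set i | c 0 i != 0].

Definition hamming_dist (x y : 'rV[K]_N) : nat := #|[set i | x 0 i != y 0 i]|.

Definition hamming_minimal (D : {vspace 'rV[K]_N}) : Prop :=
  forall c c', c \in D -> c' \in D -> c' != 0 ->
    hamming_supp c' \subset hamming_supp c -> exists a : K, c' = a *: c.

Definition row_space k (G : 'M[K]_(k, N)) : {vspace 'rV[K]_N} :=
  <<[seq row i G | i : 'I_k]>>%VS.

Definition generator_matrix k (G : 'M[K]_(k, N)) (C : {vspace 'rV[K]_N}) : Prop :=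
  basis_of C [seq row i G | i : 'I_k].

Definition monomially_equivalent (D D' : {vspace 'rV[K]_N}) : Prop :=
  exists f : 'End('rV[K]_N),
    (forall x y, hamming_dist (f x) (f y) = hamming_dist x y) /\
    D = (f @: D')%VS.

End HammingMetric.

Section AssociatedCode.
Variables (F : finFieldType) (L : fieldExtType F) (n k : nat).

(* 'cV[L]_k is a vector space over L only; its F-space structure is obtained by
   viewing column vectors as functions {ffun 'I_k -> L}, which form a
   vectType F. *)
Definition vecF (w : 'cV[L]_k) : {ffun 'I_k -> L} := [ffun i => w i 0].

Definition colspanF (G : 'M[L]_(k, n)) : {vspace {ffun 'I_k -> L}} :=
  <<[seq vecF (col j G) | j : 'I_n]>>%VS.

(* The L-line <w> as an F-subspace; see mem_lineF. *)
Definition lineF (w : 'cV[L]_k) : {vspace {ffun 'I_k -> L}} :=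
  limg (linfun (fun a : L => vecF (a *: w))).

Lemma vecF_line_linear (w : 'cV[L]_k) : linear (fun a : L => vecF (a *: w)).
Proof.
by move=> c a b; apply/ffunP => i; rewrite !ffunE !mxE mulrDl scalerAl.
Qed.

Lemma mem_lineF (w u : 'cV[L]_k) :
  reflect (exists a : L, u = a *: w) (vecF u \in lineF w).
Proof.
pose isL := GRing.isLinear.Build _ _ _ _ _ (vecF_line_linear w).
pose g : {linear L -> {ffun 'I_k -> L}} :=
  HB.pack (fun a : L => vecF (a *: w)) isL.
have linE a : linfun (fun a : L => vecF (a *: w)) a = vecF (a *: w).
  exact: (lfunE g).
apply: (iffP memv_imgP) => [[a _]|[a ->]]; last first.
  by exists a; rewrite ?memvf ?linE.
rewrite linE => /ffunP uE; exists a; apply/colP => i.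
by have := uE i; rewrite !ffunE.
Qed.

Definition wtU (U : {vspace {ffun 'I_k -> L}}) (w : 'cV[L]_k) : nat :=
  \dim (U :&: lineF w).

Definition multU (U : {vspace {ffun 'I_k -> L}}) (w : 'cV[L]_k) : nat :=
  ((#|F| ^ wtU U w - 1) %/ (#|F| - 1))%N.

End AssociatedCode.

Definition ext_length (F : finFieldType) (n : nat) : nat :=
  ((#|F| ^ n - 1) %/ (#|F| - 1))%N.

(* Points of PG(k-1, q^m) are the lines <[w]> with w != 0. *)
Definition is_Gext (F : finFieldType) (L : fieldExtType F) (n k : nat)
    (G : 'M[L]_(k, n)) (GE : 'M[L]_(k, ext_length F n)) : Prop :=
  (forall j, col j GE != 0) /\
  (forall w : 'cV[L]_k, w != 0 ->
     #|[set j | (<[col j GE]> == <[w]>)%VS]| = multU (colspanF G) w).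

Definition associated_hamming_code (F : finFieldType) (L : fieldExtType F)
    (n k : nat) (C : {vspace 'rV[L]_n})
    (D : {vspace 'rV[L]_(ext_length F n)}) : Prop :=
  exists (G : 'M[L]_(k, n)) (GE : 'M[L]_(k, ext_length F n)),
    [/\ generator_matrix G C, is_Gext G GE
      & monomially_equivalent D (row_space GE)].

(* Main.v *)
Require Import Defs.
From mathcomp Require Import all_boot all_algebra.
From mathcomp Require Import falgebra fieldext finfield.

(* Both notions of minimality are read off generator matrices.  For [y] in F^n
   one has [v *m y = 0] iff [y] is orthogonal to the rank support of [v], so by
   duality supp(v') <= supp(v) iff [v *m y = 0] implies [v' *m y = 0].  Writing
   v = xG and v' = x'G, this says that x' vanishes on every vector of U on which
   x vanishes.  The columns of G_Ext span exactly the points meeting U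
   nontrivially, so this is also the inclusion of the Hamming supports of
   x' G_Ext and x G_Ext.  Finally, linear Hamming isometries permute supports. *)

Import GRing.Theory.
Local Open Scope ring_scope.

Local Notation lift_mx L := (map_mx (in_alg L)).

(** * Finite spans, row spaces and generator matrices *)

Lemma span_imageP (K : fieldType) (vT : vectType K) (k : nat) (f : 'I_k -> vT)
    (w : vT) :
  reflect (exists c : 'I_k -> K, w = \sum_i c i *: f i)
          (w \in <<[seq f i | i : 'I_k]>>%VS).
Proof.
rewrite span_def big_image /=.
apply: (iffP memv_sumP) => [[u uP ->]|[c ->]].
  have /fin_all_exists[c cE] : forall i, exists a, u i = a *: f i.
    by move=> i; apply/vlineP/uP.
  by exists c; apply: eq_bigr.
by exists (fun i => c i *: f i) => // i _; rewrite memvZ ?memv_line.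
Qed.

Lemma col_mulmx (R : pzSemiRingType) (m n p : nat) (A : 'M[R]_(m, n))
    (B : 'M_(n, p)) j :
  col j (A *m B) = A *m col j B.
Proof. by rewrite !colE mulmxA. Qed.

Lemma row_spaceP {K : fieldType} {N k : nat} {G : 'M[K]_(k, N)} {v : 'rV[K]_N} :
  reflect (exists x : 'rV[K]_k, v = x *m G) (v \in row_space G).
Proof.
apply: (iffP (span_imageP _ _ _ _ _)) => [[c ->]|[x ->]].
  exists (\row_i c i); rewrite mulmx_sum_row.
  by apply: eq_bigr => i _; rewrite mxE.
by exists (x 0); rewrite mulmx_sum_row.
Qed.

Lemma generator_matrix_inj {K : fieldType} {N k : nat} {G : 'M[K]_(k, N)}
    {C : {vspace 'rV[K]_N}} (x : 'rV[K]_k) :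
  generator_matrix G C -> x *m G = 0 -> x = 0.
Proof.
case/andP=> _ Gfree xG0; apply/rowP => i; rewrite mxE.
have szG : size [seq row i G | i : 'I_k] == k by rewrite size_image card_ord.
have /freeP/(_ (x 0)) : free (Tuple szG) by [].
apply; rewrite -[RHS]xG0 mulmx_sum_row; apply: eq_bigr => j _.
by rewrite /= (nth_map j) ?size_enum_ord // nth_ord_enum.
Qed.

Lemma generator_matrix_row_space {K : fieldType} {N k : nat}
    {G : 'M[K]_(k, N)} {C : {vspace 'rV[K]_N}} :
  generator_matrix G C -> row_space G = C.
Proof. by case/andP=> /eqP. Qed.

(** * Linear Hamming isometries and their action on supports *)

Section HammingIsometry.
Context {K : fieldType} {N : nat}.
Implicit Types (x y : 'rV[K]_N) (D : {vspace 'rV[K]_N}).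

Lemma hamming_dist0 x : hamming_dist x 0 = #|hamming_supp x|.
Proof. by apply: eq_card => i; rewrite !inE mxE. Qed.

Lemma hamming_supp_delta i : hamming_supp (delta_mx 0 i : 'rV[K]_N) = [set i].
Proof.
apply/setP=> j; rewrite !inE mxE eqxx /=.
by case: (j == i); rewrite ?oner_eq0 ?eqxx.
Qed.

(** Unit vectors have weight 1, hence so do their images; [s i] is the only nonzero position of the
    image of the [i]-th one. *)
Lemma hamming_isometry_supp (f : 'End('rV[K]_N)) :
    (forall x y, hamming_dist (f x) (f y) = hamming_dist x y) ->
  exists2 s : 'I_N -> 'I_N, injective s &
    forall x, hamming_supp (f x) = s @: hamming_supp x.
Proof.
move=> f_iso.
have f_wt x : #|hamming_supp (f x)| = #|hamming_supp x|.
  by rewrite -!hamming_dist0 -(f_iso x 0) linear0.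
have /fin_all_exists[s sE] i :
    exists t, hamming_supp (f (delta_mx 0 i)) = [set t].
  by apply/cards1P; rewrite f_wt hamming_supp_delta cards1.
have feE i t : (f (delta_mx 0 i) 0 t != 0) = (t == s i).
  by have /setP/(_ t) := sE i; rewrite !inE.
have s_inj : injective s.
  (* If [s i = s j] with [i != j], two vectors at distance 2 would have images differing at most at
     position [s i]. *)
  move=> i j sij; apply/eqP/idPn => neq_ij.
  have := f_iso (delta_mx 0 i) (- delta_mx 0 j).
  have -> : hamming_dist (delta_mx 0 i) (- delta_mx 0 j : 'rV[K]_N) = 2%N.
    have <- : #|[set i; j]| = 2%N by rewrite cards2 neq_ij.
    apply: eq_card => t; rewrite !inE !mxE eqxx /= -subr_eq0 opprK.
    have [->|_] := eqVneq t i; have [tj|_] := eqVneq _ j => /=.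
    - by rewrite tj eqxx in neq_ij.
    - by rewrite addr0 oner_eq0.
    - by rewrite add0r oner_eq0.
    - by rewrite addr0 eqxx.
  move=> d2; suff: (2 <= #|[set s i]|)%N by rewrite cards1.
  rewrite -d2; apply/subset_leq_card/subsetP => t; rewrite !inE => ft.
  apply: contraNT ft => nt; rewrite linearN mxE.
  have /negbFE/eqP-> : (f (delta_mx 0 i) 0 t != 0) = false.
    by rewrite feE (negbTE nt).
  have /negbFE/eqP-> : (f (delta_mx 0 j) 0 t != 0) = false.
    by rewrite feE -sij (negbTE nt).
  by rewrite oppr0.
exists s => // x.
(* At position [s i] only the [i]-th unit vector contributes, so that entry of [f x] is a nonzero
   multiple of [x 0 i]. *)
have supp_s i : (s i \in hamming_supp (f x)) = (i \in hamming_supp x).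
  rewrite !inE {1}[x]row_sum_delta linear_sum summxE (bigD1 i) //= big1.
    by rewrite addr0 linearZ mxE mulf_eq0 negb_or feE eqxx andbT.
  move=> j neq_ji; rewrite linearZ mxE.
  have /negbFE/eqP-> : (f (delta_mx 0 j) 0 (s i) != 0) = false.
    by rewrite feE (inj_eq s_inj) eq_sym (negbTE neq_ji).
  by rewrite mulr0.
(* An injective self-map of ['I_N] is onto, so every position is some [s i]. *)
apply/setP=> t; have [g _ gK] := injF_bij s_inj.
by rewrite -[t]gK supp_s mem_imset.
Qed.

(** The isometry preserves and reflects support inclusion, is injective because it preserves
    distance 0, and commutes with scalars. *)
Lemma monomially_equivalent_minimal D D' :
  monomially_equivalent D D' -> hamming_minimal D <-> hamming_minimal D'.
Proof.
case=> f [f_iso ->]; have [s s_inj suppE] := hamming_isometry_supp _ f_iso.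
have sub_f x y : (hamming_supp (f x) \subset hamming_supp (f y))
               = (hamming_supp x \subset hamming_supp y).
  rewrite !suppE; apply/idP/idP => [/subsetP sub_s|]; last exact: imsetS.
  by apply/subsetP=> i xi; rewrite -(mem_imset _ _ s_inj) sub_s ?imset_f.
have f_inj x y : f x = f y -> x = y.
  move=> fxy; have /eqP := f_iso x y.
  rewrite {1}fxy {1}/hamming_dist; set A := [set _ | _].
  have -> : A = set0 by apply/setP=> i; rewrite !inE eqxx.
  rewrite cards0 eq_sym cards_eq0 => /eqP/setP eq_xy.
  by apply/rowP=> i; have := eq_xy i; rewrite !inE => /negbFE/eqP.
split=> minD.
  move=> c c' cD c'D c'n0 sub_c.
  have [||||a] := minD (f c) (f c'); rewrite ?memv_img ?sub_f //.
    by apply: contraNneq c'n0 => fc0; apply/eqP/f_inj; rewrite fc0 linear0.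
  by rewrite -linearZ => /f_inj ->; exists a.
move=> _ _ /memv_imgP[c cD ->] /memv_imgP[c' c'D ->] fc'n0.
rewrite sub_f => sub_c.
have [|a ->] := minD c c' cD c'D _ sub_c; last by exists a; rewrite linearZ.
by apply: contraNneq fc'n0 => ->; rewrite linear0.
Qed.

End HammingIsometry.

(** * Rank supports and orthogonality over [F] *)

Section RankSupport.
Context {F : finFieldType} {L : fieldExtType F} {n m : nat}.
Context {Gam : m.-tuple L} (hGam : basis_of {:L} Gam).
Implicit Types (v : 'rV[L]_n) (y : 'cV[F]_n).

(** Expanding the entries of [v] in the basis [Gam], the coordinates of the scalar [v y] are the
    entries of the transposed coordinate matrix times [y]. *)
Lemma mul_lift_eq0 v y :
  (v *m lift_mx L y == 0) = ((coord_mx Gam v)^T *m y == 0).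
Proof.
have vyE : (v *m lift_mx L y) 0 0
         = \sum_j ((coord_mx Gam v)^T *m y) j 0 *: Gam`_j.
  rewrite mxE; under [RHS]eq_bigr => j _ do rewrite mxE scaler_suml.
  rewrite exchange_big; apply: eq_bigr => i _; rewrite mxE /= mulrC mulr_algl.
  rewrite {1}(coord_basis hGam (memvf (v 0 i))) scaler_sumr.
  by apply: eq_bigr => j _; rewrite !mxE scalerA mulrC.
apply/eqP/eqP => [vy0|Ay0].
  move/basis_free/freeP: hGam => freeG.
  apply/colP=> j; rewrite [RHS]mxE.
  by apply: (freeG (fun j => _ j 0)); rewrite -vyE vy0 mxE.
apply/matrixP=> i j; rewrite !ord1 vyE Ay0 mxE big1 // => t _.
by rewrite mxE scale0r.
Qed.

Lemma rank_supp_subP v' v :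
  (rank_supp Gam v' <= rank_supp Gam v)%VS <->
  (forall y, v *m lift_mx L y = 0 -> v' *m lift_mx L y = 0).
Proof.
set A := (coord_mx Gam v)^T; set A' := (coord_mx Gam v')^T.
have colE w j : col j (coord_mx Gam w) = (row j (coord_mx Gam w)^T)^T.
  by rewrite tr_row trmxK.
(* Transposing turns column spaces into row spaces, where [submxE] expresses inclusion as
   [A' *m cokermx A = 0]. *)
have -> : (rank_supp Gam v' <= rank_supp Gam v)%VS = (A' <= A)%MS.
  apply/span_subvP/row_subP => [sub_v j|sub_A _ /imageP[j _ ->]].
    have /span_imageP[c /(congr1 trmx)] :
        col j (coord_mx Gam v') \in rank_supp Gam v.
      by apply/sub_v/imageP; exists j.
    rewrite colE trmxK -/A' => ->; apply/submxP; exists (\row_i c i).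
    rewrite mulmx_sum_row raddf_sum; apply: eq_bigr => i _.
    by rewrite /= linearZ /= colE trmxK mxE.
  apply/span_imageP; have /submxP[c cE] := sub_A j; exists (c 0).
  rewrite colE -/A' cE mulmx_sum_row raddf_sum; apply: eq_bigr => i _.
  by rewrite /= linearZ /= colE.
rewrite submxE; split=> [/eqP A'A0 y /eqP|sub_y].
  rewrite mul_lift_eq0 -/A => Ay0; apply/eqP.
  rewrite mul_lift_eq0 -/A'; suff /submxP[B ->] : (A' <= A)%MS.
    by rewrite -mulmxA (eqP Ay0) mulmx0.
  by rewrite submxE A'A0.
(* The hypothesis is tested on each column of [cokermx A], which [A] annihilates. *)
apply/eqP/trmx_inj/row_matrixP => j; rewrite -tr_col trmx0 row0.
rewrite col_mulmx; apply: trmx_inj; rewrite trmxK trmx0.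
apply/eqP; rewrite -mul_lift_eq0; apply/eqP/sub_y/eqP.
by rewrite mul_lift_eq0 -col_mulmx mulmx_coker col0.
Qed.

End RankSupport.

(** * The [F]-span of the columns of [G] and the columns of the extended matrix *)

Section Extension.
Context {F : finFieldType} {L : fieldExtType F} {n k : nat}.
Context {G : 'M[L]_(k, n)}.
Implicit Types (u w : 'cV[L]_k) (x : 'rV[L]_k).

Lemma vecF_inj : injective (@vecF F L k).
Proof.
by move=> u w /ffunP uw; apply/colP=> i; have := uw i; rewrite !ffunE.
Qed.

Lemma colspanFP u :
  reflect (exists y : 'cV[F]_n, u = G *m lift_mx L y)
          (vecF u \in colspanF G).
Proof.
have GyE (y : 'cV[F]_n) :
    vecF (G *m lift_mx L y) = \sum_j y j 0 *: vecF (col j G).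
  apply/ffunP=> i; rewrite sum_ffunE ffunE mxE; apply: eq_bigr => j _.
  by rewrite !ffunE !mxE /= mulrC mulr_algl.
apply: (iffP (span_imageP _ _ _ _ _)) => [[c uE]|[y ->]].
  exists (\col_j c j); apply: vecF_inj; rewrite uE GyE.
  by apply: eq_bigr => j _; rewrite mxE.
by exists (fun j => y j 0); rewrite GyE.
Qed.

(** The quotient is positive exactly when the weight is, that is, when [U] meets the line of [w] in
    a nonzero vector. *)
Lemma multU_gt0 (U : {vspace {ffun 'I_k -> L}}) w :
  (0 < multU U w)%N <->
  exists u, [/\ u != 0, vecF u \in U & exists a, u = a *: w].
Proof.
have q_gt1 : (1 < #|F|)%N by apply: card_finNzRing_gt1.
rewrite /multU divn_gt0 ?subn_gt0 //.
have -> : (#|F| - 1 <= #|F| ^ wtU U w - 1)%N = (0 < wtU U w)%N.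
  case: (wtU U w) => [|t].
    by rewrite expn0 subnn leqn0 subn_eq0 leqNgt q_gt1.
  by rewrite leq_sub2r // -{1}[#|F|]expn1 leq_exp2l.
rewrite lt0n dimv_eq0.
have vecF0 : vecF 0 = 0 :> {ffun 'I_k -> L}.
  by apply/ffunP=> i; rewrite !ffunE mxE.
split=> [Un0|[u [un0 uU uw]]].
  have := memv_pick (U :&: lineF w); rewrite -vpick0 in Un0.
  move: Un0; set z := vpick _ => zn0.
  have -> : z = vecF (\col_i z i) by apply/ffunP=> i; rewrite ffunE mxE.
  rewrite memv_cap => /andP[zU /mem_lineF zw].
  exists (\col_i z i); split=> //; apply: contraNneq zn0 => /colP z0.
  by apply/eqP/ffunP=> i; have := z0 i; rewrite !mxE ffunE.
apply: contraNneq un0 => U0; rewrite -(inj_eq vecF_inj) vecF0 -memv0 -U0.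
by rewrite memv_cap uU; apply/mem_lineF.
Qed.

Context {GE : 'M[L]_(k, ext_length F n)} (hGE : is_Gext G GE).

(** Column [j] is counted among the columns spanning its own point, so this point has positive
    multiplicity. *)
Lemma Gext_colP j :
  exists2 y : 'cV[F]_n,
    G *m lift_mx L y != 0 &
    exists a, G *m lift_mx L y = a *: col j GE.
Proof.
case: hGE => coln0 /(_ _ (coln0 j)) cardE.
have /multU_gt0[u [un0 /colspanFP[y uE] uw]] :
    (0 < multU (colspanF G) (col j GE))%N.
  by rewrite -cardE card_gt0; apply/set0Pn; exists j; rewrite inE.
by exists y; rewrite -uE.
Qed.

(** A nonzero vector of the span gives its own point positive multiplicity, so some column
    represents that point. *)
Lemma Gext_meets (y : 'cV[F]_n) :
  G *m lift_mx L y != 0 ->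
  exists j a, G *m lift_mx L y = a *: col j GE.
Proof.
case: hGE => _ cardE un0.
have : (0 < multU (colspanF G) (G *m lift_mx L y))%N.
  apply/multU_gt0; exists (G *m lift_mx L y); split=> //.
    by apply/colspanFP; exists y.
  by exists 1; rewrite scale1r.
rewrite -(cardE _ un0) card_gt0 => /set0Pn[j]; rewrite inE => /eqP lineE.
by exists j; apply/vlineP; rewrite lineE memv_line.
Qed.

Lemma mem_hamming_supp_Gext x j :
  (j \in hamming_supp (x *m GE)) = (x *m col j GE != 0).
Proof.
rewrite inE -col_mulmx; congr (~~ _); apply/eqP/eqP => [x0|/colP/(_ 0)].
  by apply/colP=> i; rewrite ord1 mxE x0 mxE.
by rewrite !mxE.
Qed.

Lemma hamming_supp_Gext_subP x' x :
  hamming_supp (x' *m GE) \subset hamming_supp (x *m GE) <->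
  (forall y : 'cV[F]_n, x *m G *m lift_mx L y = 0 ->
     x' *m G *m lift_mx L y = 0).
Proof.
split=> [/subsetP sub_x y|sub_y].
  rewrite -!mulmxA.
  have [->|/Gext_meets[j [a ->]]] := eqVneq (G *m lift_mx L y) 0.
    by rewrite !mulmx0.
  (* For nonzero [a], a row vector annihilates [G y] if and only if it annihilates column [j]. *)
  have [->|an0] := eqVneq a 0; first by rewrite !scale0r !mulmx0.
  rewrite -!scalemxAr => /eqP; rewrite scaler_eq0 (negbTE an0) /= => xj0.
  have := contra (sub_x j); rewrite !mem_hamming_supp_Gext !negbK.
  by move/(_ xj0)/eqP->; rewrite scaler0.
apply/subsetP=> j; rewrite !mem_hamming_supp_Gext; apply: contraNN => /eqP xj0.
have [y Gyn0 [a GyE]] := Gext_colP j.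
have := sub_y y; rewrite -!mulmxA GyE -!scalemxAr xj0 scaler0.
move/(_ erefl)/eqP; rewrite scaler_eq0 => /orP[/eqP a0|//].
by rewrite GyE a0 scale0r eqxx in Gyn0.
Qed.

(** A codeword vanishes when its support lies in that of zero, so the support criterion is applied
    to [x] and [0]. *)
Lemma mul_Gext_eq0 x : (x *m GE = 0) <-> (x *m G = 0).
Proof.
have /iffLR/= sub1 := hamming_supp_Gext_subP x 0.
have /iffRL/= sub2 := hamming_supp_Gext_subP x 0.
split=> [x0|xG0].
  (* Taking a unit vector for [y] extracts the [i]-th entry of [x *m G]. *)
  apply/rowP=> i; have := sub1 _ (delta_mx i 0).
  rewrite !mul0mx x0 => /(_ (subxx _) erefl)/rowP/(_ 0).
  by rewrite map_delta_mx -colE !mxE.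
have : hamming_supp (x *m GE) \subset hamming_supp (0 *m GE).
  by apply: sub2 => y; rewrite xG0 !mul0mx.
move/subsetP=> sub; apply/rowP=> i; have := contra (sub i).
by rewrite mul0mx !inE !mxE !negbK eqxx => /(_ isT)/eqP.
Qed.

End Extension.

(** * Transfer of minimality between the two codes *)

Theorem theorem5p13 (F : finFieldType) (L : fieldExtType F) (n m k d : nat)
  (Gam : m.-tuple L) (C : {vspace 'rV[L]_n})
  (CH : {vspace 'rV[L]_(ext_length F n)})
  (hn : (0 < n)%N) (hk : (0 < k)%N)
  (hGam : basis_of {:L} Gam)
  (hC : rank_metric_code Gam C k d)
  (hnd : rank_nondegenerate Gam C)
  (hCH : associated_hamming_code k C CH) :
  rank_minimal Gam C <-> hamming_minimal CH.
Proof.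
case: hCH => G [GE [genG hGE /monomially_equivalent_minimal minE]].
apply: (iff_trans _ (iff_sym minE)).
have memC v : v \in C -> exists x : 'rV_k, v = x *m G.
  by rewrite -(generator_matrix_row_space genG) => /row_spaceP.
have inC (x : 'rV_k) : x *m G \in C.
  by rewrite -(generator_matrix_row_space genG); apply/row_spaceP; exists x.
split=> minC.
  move=> _ _ /row_spaceP[x ->] /row_spaceP[x' ->] _.
  move/(hamming_supp_Gext_subP hGE)/(rank_supp_subP hGam).
  move/(minC _ _ (inC x) (inC x')) => [a x'E]; exists a.
  (* Proportionality of codewords lifts to [x'] and [x], since the rows of [G] are independent. *)
  suff /eqP : x' - a *: x = 0 by rewrite subr_eq0 scalemxAl => /eqP<-.
  by apply: (generator_matrix_inj _ genG); rewrite mulmxBl -scalemxAl x'E subrr.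
move=> _ _ /memC[x ->] /memC[x' ->].
move/(rank_supp_subP hGam)/(hamming_supp_Gext_subP hGE) => sub_x.
(* Hamming minimality only concerns nonzero [c']; the zero case is settled by the scalar 0. *)
have [x'0|x'n0] := eqVneq (x' *m GE) 0.
  by exists 0; rewrite scale0r; apply/(mul_Gext_eq0 hGE).
have [||a x'E] := minC (x *m GE) (x' *m GE) _ _ x'n0 sub_x.
- by apply/row_spaceP; exists x.
- by apply/row_spaceP; exists x'.
(* The same scalar works for [G], because [x' - a *: x] is annihilated by [GE] and hence by [G]. *)
exists a; apply/eqP; rewrite scalemxAl -subr_eq0 -mulmxBl; apply/eqP.
by apply/(mul_Gext_eq0 hGE); rewrite mulmxBl -scalemxAl x'E subrr.
Qed.
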